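(* Let $B$ be any infinite subset of $\mathbb N=\{1,2,\ldots\}$ and let $f\colon\mathbb N\to[\min B,\infty)$ be any function such that $\lim_{n\to\infty}f(n)=\infty$. Then the set \[G(B,f)=\left\{x\in\mathbb I\colon a_n(x)\in B \text{ and } a_n(x)\leq f(n)\text{ for all }n\in\mathbb N,\ \text{and } \lim_{n\to\infty}a_n(x)=\infty\right\}\] has Hausdorff dimension \[\dim_H G(B,f)=\frac{\tau(B)}{2}.\]
   Context: $\mathbb I$ denotes the set of irrational numbers in $(0,1)$. Each $x\in\mathbb I$ has a unique infinite (regular) continued fraction expansion $x=1/(a_1(x)+1/(a_2(x)+\cdots))$ with positive integers $a_n(x)$, called the partial quotients of $x$. $\dim_H$ denotes Hausdorff dimension (with respect to the Euclidean metric on $\mathbb R$). For an infinite subset $B$ of $\mathbb N$, the exponent of convergence of $B$ is \[\tau(B)=\inf\left\{s\geq0\colon\sum_{k\in B}k^{-s}<\infty\right\}.\] *)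

(* Defs.v *)
From mathcomp Require Import all_boot all_order all_algebra.
From mathcomp Require Import all_classical all_reals all_analysis.

Set Implicit Arguments.
Unset Strict Implicit.
Unset Printing Implicit Defensive.

Import Order.TTheory GRing.Theory Num.Theory.
Import numFieldNormedType.Exports.

Local Open Scope classical_set_scope.
Local Open Scope ring_scope.

Section HausdorffDimension.
Context {R : realType} {T : metricType R}.
Implicit Types (A : set T) (s delta : R).
Local Open Scope ereal_scope.

(* [ediam set0 = -oo], the supremum of the empty set. *)
Definition ediam A : \bar R :=
  ereal_sup [set (mdist x y)%:E | x in A & y in A].

(* [poweR] satisfies [0 `^ 0 = 1], so a singleton has weight 1 when [s = 0].
   The empty set is given weight 0 for every [s], which lets a finite cover be
   padded to an infinite one. *)
Definition diam_pow s A : \bar R :=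
  if A == set0 then 0 else ediam A `^ s.

Definition delta_cover delta A : set (nat -> set T) :=
  [set U | (forall i, ediam (U i) <= delta%:E) /\ A `<=` \bigcup_i U i].

Definition hausdorff_premeasure s delta A : \bar R :=
  ereal_inf [set \sum_(0 <= i <oo) diam_pow s (U i) | U in delta_cover delta A].

Definition hausdorff_measure s A : \bar R :=
  ereal_sup [set hausdorff_premeasure s delta A
            | delta in [set delta | (0 < delta)%R]].

Definition hausdorff_dim A : \bar R :=
  ereal_inf [set s%:E
            | s in [set s | (0 <= s)%R /\ hausdorff_measure s A = 0]].

End HausdorffDimension.

Section ContinuedFraction.
Context {R : realType}.
Implicit Types (a : nat -> nat) (x : R).

Definition irrational01 : set R := irrational `&` `]0, 1[.

(* The finite continued fraction 1/(a 1 + 1/(a 2 + ... + 1/(a n))), which is 0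
   when n = 0. *)
Definition convergent a (n : nat) : R :=
  foldr (fun (k : nat) (y : R) => (k%:R + y)^-1) 0 [seq a i | i <- iota 1 n].

(* Partial quotients are numbered from 1; the value at 0 carries no information
   and is set to 0 so that the expansion of an irrational number is unique. *)
Definition cf_expansion x : set (nat -> nat) :=
  [set a | [/\ a 0%N = 0%N, forall n, (0 < n)%N -> (0 < a n)%N
             & convergent a n @[n --> \oo] --> x]].

(* The unique element of [cf_expansion x] when [x] is in [irrational01]; the
   default is irrelevant there. *)
Definition partial_quotient x : nat -> nat :=
  xget (fun=> 0%N) (cf_expansion x).

End ContinuedFraction.

Definition exponent_of_convergence (R : realType) (B : set nat) : \bar R :=
  ereal_inf [set s%:E | s in
    [set s : R | 0 <= s /\ (\esum_(k in B) (k%:R `^ (- s))%:E < +oo)%E]].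

Definition G (R : realType) (B : set nat) (f : nat -> R) : set R :=
  [set x | [/\ irrational01 x,
               forall n, (0 < n)%N ->
                 B (partial_quotient x n) /\ (partial_quotient x n)%:R <= f n
             & partial_quotient x n @[n --> \oo] --> \oo]].

(* Main.v *)
Require Import Defs.
From mathcomp Require Import all_boot all_order all_algebra.
From mathcomp Require Import all_classical all_reals all_analysis.
From mathcomp Require Import ring lra.

(* Upper bound: if sum_(k in B) k^(-2s) converges, choose M with
   sum_(k in B, k >= M) k^(-2s) < 1. The set E of continued fractions with all
   digits in B and >= M is covered by its images under x |-> 1 / (k + x), which
   is k^(-2)-Lipschitz, so the s-dimensional Hausdorff content c of E satisfies
   c <= c * sum_(k in B, k >= M) k^(-2s). As c is finite, c = 0, and G(B, f) is
   covered by countably many Lipschitz images of E.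

   Lower bound: if sum_(k in B) k^(-2s) diverges, let the n-th digit range over a
   finite subset A_n of B whose elements tend to infinity so slowly that they
   stay below f and grow at most exponentially, but with
   S_n = sum_(k in A_n) (k + 1)^(-2s) >= 2. Coding u in [0, 1[ by subdividing
   successively in proportion to (k + 1)^(-2s) / S_n, one gets a map
   u |-> x(u) into G(B, f). If u and v share exactly n digits a_i, then
   |u - v| <= prod_i (a_i + 1)^(-2s) / S_i, while |x(u) - x(v)| is at least
   prod_i (a_i + 1)^(-2) times a factor bounded below in terms of A_n. The gain
   2^n in prod_i S_i absorbs that factor, so |u - v| <= C |x(u) - x(v)|^s, and
   the Lebesgue measure of [0, 1[ bounds the s-measure of G(B, f) from below. *)

Import Order.TTheory GRing.Theory Num.Theory.
Import numFieldNormedType.Exports.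

Local Open Scope classical_set_scope.
Local Open Scope ring_scope.

(** * Convergence, uniqueness and irrationality of infinite continued fractions *)

Section ContinuedFractions.
Context {R : realType}.
Implicit Types (b c : nat -> nat) (x y : R).

(** Digits are indexed from 0 here, so that removing the first one is composition with [succn], as
    induction on the tail requires. *)
Fixpoint cfrac b n : R :=
  if n is n'.+1 then ((b 0%N)%:R + cfrac (b \o succn) n')^-1 else 0.

Lemma convergentE a n : convergent a n = cfrac (a \o succn) n.
Proof.
rewrite /convergent.
have -> : [seq a i | i <- iota 1 n] = [seq (a \o succn) i | i <- iota 0 n].
  by rewrite -[1%N]/(1 + 0)%N iotaDl -map_comp.
elim: n (a \o succn) => [//|n IH] b /=; congr (_ + _)^-1.
by rewrite -[1%N]/(1 + 0)%N iotaDl -map_comp IH.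
Qed.

Definition positive_digits b := forall n, (0 < b n)%N.

Lemma positive_digits_shift {b} : positive_digits b -> positive_digits (b \o succn).
Proof. by move=> b0 n; exact: b0. Qed.

Lemma natr_ge1 {k : nat} : (0 < k)%N -> 1 <= k%:R :> R.
Proof. by rewrite ler1n. Qed.

Lemma cfrac01 {b} n : positive_digits b -> 0 <= cfrac b n <= 1.
Proof.
elim: n b => [|n IH] b b0 /=; first by rewrite lexx ler01.
have /andP[c0 c1] := IH _ (positive_digits_shift b0).
have b1 := natr_ge1 (b0 0%N).
by rewrite invr_ge0 invf_le1; lra.
Qed.

Lemma dist_invD (k x y : R) : 0 < k + x -> 0 < k + y ->
  `|(k + x)^-1 - (k + y)^-1| = `|x - y| / ((k + x) * (k + y)).
Proof.
move=> x0 y0.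
have -> : (k + x)^-1 - (k + y)^-1 = (y - x) / ((k + x) * (k + y)).
  by field; lra.
by rewrite normrM distrC [X in _ * X]gtr0_norm // invr_gt0 mulr_gt0.
Qed.

(* One step need not contract near 0 when the digit is 1, but two steps
   contract by a factor of at most 1/4. *)
Lemma dist_invD2 (k l x y : R) : 1 <= k -> 1 <= l -> 0 <= x -> 0 <= y ->
  `|(k + (l + x)^-1)^-1 - (k + (l + y)^-1)^-1| <= 4^-1 * `|x - y|.
Proof.
move=> k1 l1 x0 y0.
have lx : 0 < (l + x)^-1 by rewrite invr_gt0; lra.
have ly : 0 < (l + y)^-1 by rewrite invr_gt0; lra.
rewrite !dist_invD; [|lra..].
rewrite -mulrA -invfM mulrC ler_wpM2r// lef_pV2 ?posrE //; last first.
  by rewrite !mulr_gt0//; lra.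
have -> : (l + x) * (l + y) * ((k + (l + x)^-1) * (k + (l + y)^-1)) =
  (k * (l + x) + 1) * (k * (l + y) + 1) by field; lra.
have : 1 <= k * (l + x) by rewrite -[1]mulr1 ler_pM//; lra.
have : 1 <= k * (l + y) by rewrite -[1]mulr1 ler_pM//; lra.
nra.
Qed.

(** Digits are peeled off in pairs, each pair gaining a factor 1/4 by [dist_invD2]; the remaining
    tails both lie in [0, 1]. Hence [cfrac b] is a Cauchy sequence. *)
Lemma dist_cfrac b k m n : positive_digits b ->
  `|cfrac b (k.*2 + m) - cfrac b (k.*2 + n)| <= 4^-1 ^+ k.
Proof.
elim: k b => [|k IH] b b0.
  have /andP[? ?] := cfrac01 m b0; have /andP[? ?] := cfrac01 n b0.
  by rewrite expr0 !add0n ler_norml; apply/andP; split; lra.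
rewrite doubleS !addSn /= exprS.
have b2 := positive_digits_shift (positive_digits_shift b0).
have /andP[m0 _] := cfrac01 (k.*2 + m) b2; have /andP[n0 _] := cfrac01 (k.*2 + n) b2.
apply: (le_trans (dist_invD2 _ _ _ _ (natr_ge1 (b0 0%N)) (natr_ge1 (b0 1%N)) m0 n0)).
by rewrite ler_wpM2l ?IH.
Qed.

Definition cf b : R := lim (cfrac b n @[n --> \oo]).

Lemma is_cvg_cfrac {b} : positive_digits b -> cvgn (cfrac b).
Proof.
move=> b0; apply/cauchy_cvgP/cauchy_exP => e e0.
have [k _ /(_ k (leqnn k)) /= ke] : \forall k \near \oo, `|4^-1 ^+ k : R| < e.
  have /cvgrPdist_lt /(_ e e0) : (4^-1 : R) ^+ n @[n --> \oo] --> 0.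
    by apply: cvg_expr; rewrite ger0_norm; lra.
  by apply: filterS => n; rewrite sub0r normrN.
exists (cfrac b (k.*2)); exists (k.*2) => // n /= kn.
rewrite /ball/= (le_lt_trans _ ke)// [leRHS]ger0_norm ?exprn_ge0//.
by have := dist_cfrac b k 0 (n - k.*2) b0; rewrite addn0 subnKC.
Qed.

Lemma cvg_cfrac {b} : positive_digits b -> cfrac b n @[n --> \oo] --> cf b.
Proof. exact: is_cvg_cfrac. Qed.

Lemma cf01 {b} : positive_digits b -> 0 <= cf b <= 1.
Proof.
move=> b0; apply/andP; split.
  apply: limr_ge; first exact: is_cvg_cfrac.
  by near=> n; have /andP[] := cfrac01 n b0.
apply: limr_le; first exact: is_cvg_cfrac.
by near=> n; have /andP[] := cfrac01 n b0.
Unshelve. all: by end_near. Qed.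

Lemma cf_rec {b} : positive_digits b -> cf b = ((b 0%N)%:R + cf (b \o succn))^-1.
Proof.
move=> b0; have b1 := positive_digits_shift b0.
have b01 := natr_ge1 (b0 0%N); have /andP[c0 c1] := cf01 b1.
apply: cvg_lim => //; rewrite -cvg_shiftS /=.
by apply: cvgV; [lra|apply: cvgD; [exact: cvg_cst|exact: cvg_cfrac]].
Qed.

Lemma cf_gt0_lt1 {b} : positive_digits b -> 0 < cf b < 1.
Proof.
move=> b0; have b1 := positive_digits_shift b0.
have c0 c : positive_digits c -> 0 < cf c.
  move=> c0; rewrite cf_rec// invr_gt0.
  have := natr_ge1 (c0 0%N); have /andP[] := cf01 (positive_digits_shift c0).
  lra.
rewrite c0//= cf_rec// invf_lt1; have := c0 _ b1; have := natr_ge1 (b0 0%N); lra.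
Qed.

Lemma natrD_inj (m n : nat) x y :
  0 < x < 1 -> 0 < y < 1 -> m%:R + x = n%:R + y -> m = n.
Proof.
move=> /andP[x0 x1] /andP[y0 y1] mn.
have : m%:R < n.+1%:R :> R by rewrite -natr1; lra.
have : n%:R < m.+1%:R :> R by rewrite -natr1; lra.
by rewrite !ltr_nat !ltnS => nm mn'; apply/eqP; rewrite eqn_leq nm mn'.
Qed.

(** The tail lies strictly between 0 and 1, so the first digit is the integer part of the inverse
    and the tail its fractional part. *)
Lemma cf_inj {b c} : positive_digits b -> positive_digits c -> cf b = cf c -> b = c.
Proof.
move=> b0 c0 bc; apply/funext => n.
elim: n b c b0 c0 bc => [|n IH] b c b0 c0;
  rewrite (cf_rec b0) (cf_rec c0) => /invr_inj bc;
  have b1 := positive_digits_shift b0; have c1 := positive_digits_shift c0;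
  have bc0 := natrD_inj _ _ _ _ (cf_gt0_lt1 b1) (cf_gt0_lt1 c1) bc.
- by [].
- by apply: (IH _ _ b1 c1); rewrite bc0 in bc; exact: addrI bc.
Qed.

(* Infinite descent: the tail of [p / q] is [(q - b 0 * p) / p] and [p < q]. *)
Lemma cf_neq_ratio {b} (p q : nat) : positive_digits b -> cf b != p%:R / q%:R.
Proof.
elim/ltn_ind: q p b => q IH p b b0; apply/eqP => bpq.
have b1 := positive_digits_shift b0.
have /andP[+ +] := cf_gt0_lt1 b0.
have /andP[+ _] := cf_gt0_lt1 b1.
move: bpq; case: q => [|q] in IH *; first by rewrite invr0 mulr0; lra.
case: p => [|p]; first by rewrite mul0r; lra.
move=> bpq c0 _; rewrite bpq ltr_pdivrMr// mul1r ltr_nat => pq.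
have := cf_rec b0; rewrite bpq => /(congr1 GRing.inv); rewrite invrK invf_div.
move=> qp; have := IH _ pq (q.+1 - b 0 * p.+1)%N _ b1; move/eqP; apply.
have p0 : 0 < p.+1%:R :> R by [].
rewrite natrB ?natrM.
  have -> : cf (b \o succn) = q.+1%:R / p.+1%:R - (b 0%N)%:R by rewrite qp addrAC subrr add0r.
  by field; lra.
by rewrite -(ler_nat R) natrM -ler_pdivlMr// qp lerDl ltW.
Qed.

Lemma irrational01_cf {b} : positive_digits b -> irrational01 (cf b).
Proof.
move=> b0; have /andP[c0 c1] := cf_gt0_lt1 b0.
split; last by rewrite /= in_itv/= c0.
move=> [q _ qb].
have /eqP := cf_neq_ratio `|numq q| `|denq q| b0; apply.
have q0 : 0 < q by rewrite -(ltr0q R) qb.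
rewrite -qb /ratr; congr (_ / _).
  by rewrite -[LHS]/((numq q)%:~R) pmulrn gez0_abs// ltW// numq_gt0.
by rewrite pmulrn gez0_abs.
Qed.

Definition digits_of b : nat -> nat := fun n => if n is n'.+1 then b n' else 0%N.

Lemma cf_expansion_digits {x a} : cf_expansion x a <->
  [/\ a 0%N = 0%N, positive_digits (a \o succn) & x = cf (a \o succn)].
Proof.
split=> [[a0 apos ax]|[a0 apos ->]]; split=> //.
- by move=> n; exact: apos.
- apply/esym/cvg_lim => //; apply: cvg_trans ax; apply: near_eq_cvg.
  by apply: nearW => n; rewrite convergentE.
- by case=> // n _; exact: apos.
- apply: cvg_trans (cvg_cfrac apos); apply: near_eq_cvg.
  by apply: nearW => n; rewrite convergentE.
Qed.

Lemma partial_quotient_cf {b} : positive_digits b ->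
  partial_quotient (cf b) = digits_of b.
Proof.
move=> b0; apply: xget_unique; first by apply/cf_expansion_digits; split.
move=> a /cf_expansion_digits[a0 apos /(cf_inj b0 apos) ba].
by apply/funext => -[|n]; rewrite ?a0//= ba.
Qed.

(** Positivity rules out the default value of [partial_quotient], which vanishes everywhere, so the
    quotients come from a genuine expansion. *)
Lemma cf_partial_quotient {x} : (forall n, (0 < n)%N -> (0 < partial_quotient x n)%N) ->
  x = cf (partial_quotient x \o succn).
Proof.
rewrite /partial_quotient; case: xgetP => [a _|_ /(_ 1%N isT)//].
by move=> /cf_expansion_digits[].
Qed.

End ContinuedFractions.

(** * Diameters and their powers *)

Section Diameter.
Context {R : realType} {T : metricType R}.
Implicit Types (A B : set T) (s : R).
Local Open Scope ereal_scope.

Lemma mdist_le_ediam {A} {x y : T} : A x -> A y -> (mdist x y)%:E <= ediam A.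
Proof. by move=> Ax Ay; apply: ereal_sup_ubound; exists x => //; exists y. Qed.

Lemma ediam_ge0 A : A !=set0 -> 0 <= ediam A.
Proof.
by move=> [x Ax]; have := mdist_le_ediam Ax Ax; rewrite mdistxx.
Qed.

Lemma ediam0 : ediam (set0 : set T) = -oo.
Proof.
by apply/ereal_sup_ninfty => _ [x []].
Qed.

Lemma diam_pow0 s : diam_pow s (set0 : set T) = 0.
Proof. by rewrite /diam_pow eqxx. Qed.

Lemma diam_powE s A : A !=set0 -> diam_pow s A = ediam A `^ s.
Proof. by rewrite /diam_pow => /set0P/negbTE ->. Qed.

Lemma diam_pow_ge0 s A : 0 <= diam_pow s A.
Proof. by rewrite /diam_pow; case: ifP => // _; exact: poweR_ge0. Qed.

(** As [ediam set0] is -oo and 0 * -oo is 0, the diameter inequality with r = 0 would admit a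
    singleton [B] and an empty [A]; the implication between nonemptiness conditions excludes
    this. *)
Lemma diam_pow_le s A B (r : R) : (0 <= s)%R -> (0 <= r)%R -> (B !=set0 -> A !=set0) ->
  (ediam B <= r%:E * ediam A) -> diam_pow s B <= (r `^ s)%:E * diam_pow s A.
Proof.
move=> s0 r0 BA dBA; have [->|/set0P B0] := eqVneq B set0.
  by rewrite diam_pow0 mule_ge0// ?lee_fin ?powR_ge0// diam_pow_ge0.
rewrite !diam_powE; [|exact: BA|by []].
have A0 := ediam_ge0 _ (BA B0); have B1 := ediam_ge0 _ B0.
rewrite -poweR_EFin -poweRM// gt0_ler_poweR// in_itv/= ?leey ?andbT//.
by rewrite mule_ge0// lee_fin.
Qed.

End Diameter.

(** * Hausdorff content and its null sets *)

Section HausdorffContent.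
Context {R : realType}.
Implicit Types (A B : set R^o) (s r : R) (phi : R -> R).
Local Open Scope ereal_scope.

(* The outer measure built from covers by arbitrary sets, without any bound on
   their diameters. *)
Definition hausdorff_content s : set R^o -> \bar R :=
  @mu_ext _ (g_sigma_algebraType [set: set R^o]) R (diam_pow s).

Lemma measurable_all (A : set (g_sigma_algebraType [set: set R^o])) : measurable A.
Proof. exact: sub_sigma_algebra. Qed.

Lemma hausdorff_content_ge0 s A : 0 <= hausdorff_content s A.
Proof. by apply: mu_ext_ge0 => X; exact: diam_pow_ge0. Qed.

Lemma le_hausdorff_content s A B : A `<=` B ->
  hausdorff_content s A <= hausdorff_content s B.
Proof. exact: (@le_mu_ext _ (g_sigma_algebraType [set: set R^o])). Qed.

Lemma hausdorff_content_bigcup s (F : nat -> set R^o) :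
  hausdorff_content s (\bigcup_n F n) <= \sum_(n <oo) hausdorff_content s (F n).
Proof. by apply: mu_ext_sigma_subadditive => X; exact: diam_pow_ge0. Qed.

Lemma hausdorff_content_le_cover s A (U : nat -> set R^o) :
  A `<=` \bigcup_i U i -> hausdorff_content s A <= \sum_(i <oo) diam_pow s (U i).
Proof.
move=> AU; apply: ereal_inf_lbound; exists U => //; split=> // i.
exact: measurable_all.
Qed.

Lemma hausdorff_content_lt_cover {s A} {e : \bar R} : hausdorff_content s A < e ->
  exists2 U : nat -> set R^o, A `<=` \bigcup_i U i & \sum_(i <oo) diam_pow s (U i) < e.
Proof. by move=> /ereal_inf_lt[_ [U [_ AU] <-]] Ue; exists U. Qed.

Lemma hausdorff_content0 s : hausdorff_content s set0 = 0.
Proof. by apply: mu_ext0 => [|X]; [exact: diam_pow0|exact: diam_pow_ge0]. Qed.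

Lemma hausdorff_content_le_diam_pow s A : hausdorff_content s A <= diam_pow s A.
Proof.
pose U n := if n is 0%N then A else set0.
apply: (le_trans (@hausdorff_content_le_cover s A U _)).
  by move=> x Ax; exists 0%N.
rewrite (@nneseriesD1 _ _ 0%N)//=; last by move=> n _; exact: diam_pow_ge0.
rewrite eseries0 ?adde0// => -[|n] _ //= _.
by rewrite diam_pow0.
Qed.

Lemma hausdorff_content_image {s r A} phi : (0 <= s)%R -> (0 < r)%R ->
  (forall x y, A x -> A y -> `|phi x - phi y| <= r * `|x - y|)%R ->
  hausdorff_content s (phi @` A : set R^o) <= (r `^ s)%:E * hausdorff_content s A.
Proof.
move=> s0 r0 lip; rewrite -lee_pdivrMl ?powR_gt0//.
apply: le_ereal_inf_tmp => _ [U [_ AU] <-].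
rewrite lee_pdivrMl ?powR_gt0// -nneseriesZl; last by move=> *; exact: diam_pow_ge0.
(* The cover is cut down to [A] first, because [phi] is Lipschitz only there. *)
pose V i := phi @` (U i `&` A) : set R^o.
apply: (le_trans (@hausdorff_content_le_cover s _ V _)).
  by move=> _ [x Ax <-]; have [i _ Ui] := AU x Ax; exists i => //; exists x.
apply: lee_nneseries => i *; first exact: diam_pow_ge0.
apply: diam_pow_le => //; first exact: ltW.
  by move=> [_ [x [Ux _] _]]; exists x.
apply: ge_ereal_sup => _ [_ [x [Ux Ax] <-] [_ [y [Uy Ay] <-] <-]].
have xy := mdist_le_ediam Ux Uy.
rewrite (@le_trans _ _ (r%:E * (mdist x y)%:E))//.
  by rewrite -EFinM lee_fin; exact: lip.
by rewrite lee_pmul2l.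
Qed.

Lemma diam_pow_le_series s (U : nat -> set R^o) i :
  diam_pow s (U i) <= \sum_(j <oo) diam_pow s (U j).
Proof.
rewrite (@nneseriesD1 _ _ i)//; last by move=> n _; exact: diam_pow_ge0.
by rewrite leeDl// nneseries_ge0// => n _ _; exact: diam_pow_ge0.
Qed.

(** A cover of total weight less than d^s consists of sets of diameter at most d. Covers witnessing
    zero content are therefore admissible at every scale. *)
Lemma hausdorff_measure_eq0 s A : (0 < s)%R -> hausdorff_content s A = 0 ->
  hausdorff_measure s A = 0.
Proof.
move=> s0 A0; apply/eqP; rewrite eq_le; apply/andP; split; last first.
  apply: (@le_trans _ _ (hausdorff_premeasure s 1 A)).
    apply: le_ereal_inf_tmp => _ [U _ <-].
    by apply: nneseries_ge0 => n _ _; exact: diam_pow_ge0.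
  by apply: ereal_sup_ubound; exists 1%R => /=.
apply: ge_ereal_sup => _ [d /= d0 <-]; apply/lee_addgt0Pr => e e0; rewrite add0e.
have : hausdorff_content s A < (Num.min e (d `^ s))%:E.
  by rewrite A0 lte_fin lt_min e0 powR_gt0.
move=> /hausdorff_content_lt_cover[U AU Ue].
apply: (@le_trans _ _ (\sum_(i <oo) diam_pow s (U i))); last first.
  by rewrite (le_trans (ltW Ue))// lee_fin ge_min lexx.
apply: ereal_inf_lbound; exists U => //; split=> // i.
have [->|/set0P Ui] := eqVneq (U i) set0; first by rewrite ediam0 leNye.
rewrite leNgt; apply/negP => dU.
have : (d `^ s)%:E <= diam_pow s (U i).
  rewrite diam_powE// -poweR_EFin gt0_ler_poweR ?in_itv/= ?leey ?andbT ?lee_fin// ?ltW//.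
  by rewrite (lt_trans _ dU)// lte_fin.
apply/negP; rewrite -ltNge (le_lt_trans (diam_pow_le_series _ _ _))//.
by rewrite (lt_le_trans Ue)// lee_fin ge_min lexx orbT.
Qed.

End HausdorffContent.

(** * Upper bound: a self-covering set of continued fractions *)

Section UpperBound.
Context {R : realType} (B : set nat).
Hypothesis B_pos : B `<=` [set k | (0 < k)%N].
Implicit Types (x y s : R) (M N k : nat).

(** For N = 0 this is the set E of the overview; in general the first N digits are exempt from the
    bound M. *)
Definition cf_tail_ge M N : set R :=
  [set x | exists b, [/\ x = cf b, forall n, B (b n) &
                         forall n, (N <= n)%N -> (M <= b n)%N]].

Definition cf_branch k x : R := (k%:R + x)^-1.

Lemma cf_tail_ge01 M N : cf_tail_ge M N `<=` [set x | 0 <= x <= 1].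
Proof. by move=> x [b [-> Bb _]]; apply: cf01 => n; exact/B_pos/Bb. Qed.

(** Dropping the first digit leaves one exempt digit fewer. Since [0.-1] is 0, the case N = 0 covers
    E by images of E itself, and only there is the first digit known to be at least M. *)
Lemma cf_tail_ge_cover M N x : cf_tail_ge M N x ->
  exists2 k, B k /\ (N = 0%N -> (M <= k)%N) & (cf_branch k @` cf_tail_ge M N.-1) x.
Proof.
move=> [b [-> Bb Mb]]; have b0 n : (0 < b n)%N by exact/B_pos/Bb.
exists (b 0%N); first by split=> // N0; apply: Mb; rewrite N0.
exists (cf (b \o succn)); last by rewrite [RHS]cf_rec.
exists (b \o succn); split=> [//|n|n Nn]; first exact: Bb.
by apply: Mb; rewrite (leq_trans (leqSpred N)).
Qed.

Lemma cf_branch_lipschitz k x y : (0 < k)%N -> 0 <= x -> 0 <= y ->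
  `|cf_branch k x - cf_branch k y| <= k%:R ^- 2 * `|x - y|.
Proof.
move=> k0 x0 y0; have k1 : 1 <= k%:R :> R := natr_ge1 k0.
rewrite dist_invD; [|lra..].
by rewrite mulrC ler_wpM2r// lef_pV2 ?posrE ?expr2; nra.
Qed.

Lemma hausdorff_content_cf_tail_ge s M N : 0 <= s ->
  (hausdorff_content s (cf_tail_ge M N : set R^o) <=
   \sum_(0 <= k <oo | `[< B k >] && ((N == 0%N) ==> (M <= k)%N))
     ((k%:R ^- 2) `^ s)%:E * hausdorff_content s (cf_tail_ge M N.-1 : set R^o))%E.
Proof.
move=> s0; pose P k := `[< B k >] && ((N == 0%N) ==> (M <= k)%N).
pose F k : set R^o := if P k then cf_branch k @` cf_tail_ge M N.-1 else set0.
have cover : cf_tail_ge M N `<=` \bigcup_k F k.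
  move=> x /cf_tail_ge_cover[k [Bk Mk] xk]; exists k => //; rewrite /F ifT//.
  by apply/andP; split; [exact/asboolP|apply/implyP => /eqP].
apply: (le_trans (le_hausdorff_content s _ _ cover)).
apply: (le_trans (hausdorff_content_bigcup s _)).
rewrite [leRHS]eseries_mkcond; apply: lee_nneseries => k *.
  exact: hausdorff_content_ge0.
rewrite /F -/(P k); case: ifPn => [/andP[/asboolP/B_pos k0 _]|_]; last first.
  by rewrite hausdorff_content0.
apply: hausdorff_content_image => //.
  by rewrite invr_gt0 exprn_gt0// ltr0n.
move=> x y /cf_tail_ge01/andP[x0 _] /cf_tail_ge01/andP[y0 _].
exact: cf_branch_lipschitz.
Qed.

(** For N = 0 the content c satisfies c <= c * t with t < 1, and c <= 1 because E lies in [0, 1];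
    hence c = 0. Each further exempt digit only adds a countable union of Lipschitz images of null
    sets. *)
Lemma hausdorff_content_cf_tail_ge_eq0 s M N : 0 <= s ->
  (\sum_(M <= k <oo | `[< B k >]) ((k%:R ^- 2) `^ s)%:E < 1%:E :> \bar R)%E ->
  hausdorff_content s (cf_tail_ge M N : set R^o) = 0%E.
Proof.
move=> s0 sum1; apply/eqP; rewrite eq_le hausdorff_content_ge0 andbT.
elim: N => [|N /= IH]; last first.
  apply: (le_trans (hausdorff_content_cf_tail_ge s M N.+1 s0)).
  rewrite eseries0// => k _ _ /=.
  suff -> : hausdorff_content s (cf_tail_ge M N : set R^o) = 0%E by rewrite mule0.
  by apply/eqP; rewrite eq_le IH hausdorff_content_ge0.
have c1 : (hausdorff_content s (cf_tail_ge M 0 : set R^o) <= 1)%E.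
  apply: (le_trans (hausdorff_content_le_diam_pow s _)).
  have [->|/set0P E0] := eqVneq (cf_tail_ge M 0 : set R^o) set0.
    by rewrite diam_pow0.
  rewrite diam_powE// -(poweR1r s) gt0_ler_poweR// ?in_itv/= ?leey ?andbT//.
    exact: ediam_ge0.
  apply: ge_ereal_sup => _ [x Ex [y Ey <-]].
  have /andP[? ?] := cf_tail_ge01 _ _ _ Ex; have /andP[? ?] := cf_tail_ge01 _ _ _ Ey.
  by rewrite lee_fin /mdist/= ler_norml; apply/andP; split; lra.
have := hausdorff_content_cf_tail_ge s M 0 s0.
move: c1 (hausdorff_content_ge0 s (cf_tail_ge M 0 : set R^o)).
case: (hausdorff_content _ _) => // c; rewrite !lee_fin => c1 c0.
under eq_eseriesr do rewrite muleC.
rewrite nneseriesZl; last by move=> *; rewrite lee_fin powR_ge0.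
rewrite eqxx/= -eseries_cond.
have : (0 <= \sum_(M <= k <oo | `[< B k >]) ((k%:R ^- 2) `^ s)%:E :> \bar R)%E.
  by apply: nneseries_ge0 => *; rewrite lee_fin powR_ge0.
case: (limn _) sum1 => // t; rewrite lte_fin lee_fin => t1 t0.
rewrite -EFinM lee_fin => ct.
by nra.
Qed.

Lemma hausdorff_measure_G_eq0 (f : nat -> R) s : 0 < s ->
  (\esum_(k in B) (k%:R `^ (- (s * 2)))%:E < +oo)%E ->
  hausdorff_measure s (G B f : set R^o) = 0%E.
Proof.
move=> s0 Bfin; apply: hausdorff_measure_eq0 => //.
have [M sumM] : exists M, (\sum_(M <= k <oo | `[< B k >]) ((k%:R ^- 2) `^ s)%:E < 1%:E :> \bar R)%E.
  have : (\sum_(0 <= k <oo | `[< B k >]) ((k%:R ^- 2) `^ s)%:E < +oo :> \bar R)%E.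
    rewrite nneseries_esum => [|*]; last by rewrite lee_fin powR_ge0.
    apply: le_lt_trans Bfin.
    rewrite (_ : [set x | _] = B); last by apply/seteqP; split => x /asboolP.
    apply: le_esum => k _; rewrite lee_fin.
    by rewrite mulrC -mulNr powRrM powR_invn.
  move/nneseries_tail_cvg => cv.
  have w0 k : `[< B k >] -> (0 <= ((k%:R ^- 2) `^ s)%:E :> \bar R)%E.
    by rewrite lee_fin powR_ge0.
  have [|M _ /(_ M (leqnn M)) ?] := cv w0 [set x | (x < 1%:E)%E]; last by exists M.
  by apply: open_ereal_lt'; rewrite lte_fin.
apply/eqP; rewrite eq_le hausdorff_content_ge0 andbT.
(* Digits tending to infinity are eventually at least M, from an index N depending on the point. *)
apply: (@le_trans _ _ (hausdorff_content s (\bigcup_N cf_tail_ge M N : set R^o))).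
  apply: le_hausdorff_content => x [_ xB xoo].
  have xpos n : (0 < n)%N -> (0 < partial_quotient x n)%N.
    by move=> n0; have [/B_pos] := xB n n0.
  have [N _ NM] : \forall n \near \oo, (M <= partial_quotient x n)%N.
    by apply: (xoo [set k | (M <= k)%N]); exists M.
  exists N => //; exists (partial_quotient x \o succn); split.
  - exact: cf_partial_quotient.
  - by move=> n; have [] := xB n.+1 isT.
  - by move=> n Nn; apply: NM => /=; rewrite leqW.
apply: (le_trans (hausdorff_content_bigcup s _)).
rewrite eseries0// => N _ _; apply: hausdorff_content_cf_tail_ge_eq0 => //.
exact: ltW.
Qed.

End UpperBound.

(** * Positive Hausdorff measure from an inverse Hölder parametrization *)

Section HolderParametrization.
Context {R : realType}.
Implicit Types (u v C s : R).

(** Mass distribution principle: a cover of [A] pulls back to a cover of [0, 1[ whose i-th member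
    fits into a set of Lebesgue measure at most 2 C (diam U_i)^s, so the total weight is at least 1
    / (2 C). *)
Lemma hausdorff_measure_neq0 (A : set R^o) (x : R -> R) s C : 0 <= s -> 0 < C ->
  (forall u, 0 <= u < 1 -> A (x u)) ->
  (forall u v, 0 <= u < 1 -> 0 <= v < 1 -> `|u - v| <= C * `|x u - x v| `^ s) ->
  hausdorff_measure s A != 0%E.
Proof.
move=> s0 C0 Ax xH.
(* One scale is enough below a supremum; the scale 1 keeps the diameters finite. *)
suff premeasure_ge : ((2 * C)^-1%:E <= hausdorff_premeasure s 1 A)%E.
  rewrite gt_eqF// (@lt_le_trans _ _ (2 * C)^-1%:E)//.
    by rewrite lte_fin invr_gt0; lra.
  by apply: (le_trans premeasure_ge); apply: ereal_sup_ubound; exists 1 => /=.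
apply: le_ereal_inf_tmp => _ [U [U1 AU] <-].
rewrite -[X in (X <= _)%E]mule1 lee_pdivrMl; last lra.
rewrite -nneseriesZl; last by move=> *; exact: diam_pow_ge0.
(* The preimage of [U i] need not be measurable, so it is enclosed in an interval of radius C (diam
   U_i)^s about one of its points. *)
have /choice[W Wp] : forall i, exists W : set R,
    [/\ measurable W, forall u, 0 <= u < 1 -> U i (x u) -> W u &
     (lebesgue_measure W <= (2 * C)%:E * diam_pow s (U i))%E].
  move=> i; have [[u u1 Uu]|noU] := pselect (exists2 u, 0 <= u < 1 & U i (x u)); last first.
    exists set0; split=> [//|u u1 Uu|]; first by apply: noU; exists u.
    by rewrite measure0 mule_ge0 ?diam_pow_ge0// lee_fin; lra.
  have U0 : U i !=set0 by exists (x u).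
  have dU0 := ediam_ge0 _ U0; have := U1 i; rewrite diam_powE//.
  case dE : (ediam (U i)) => [d| |] //; last by rewrite dE in dU0.
  move=> _; have d0 : 0 <= d by rewrite dE lee_fin in dU0.
  have r0 : 0 <= C * d `^ s by rewrite mulr_ge0 ?powR_ge0// ltW.
  exists [set` `[u - C * d `^ s, u + C * d `^ s]]; split=> [//|v v1 Uv|].
    have : `|u - v| <= C * d `^ s.
      apply: (le_trans (xH _ _ u1 v1)); rewrite ler_wpM2l ?(ltW C0)//.
      rewrite ge0_ler_powR ?nnegrE//.
      by have := @mdist_le_ediam R R^o _ _ _ Uv Uu; rewrite dE lee_fin.
    by rewrite ler_norml /= in_itv/= => /andP[? ?]; apply/andP; split; lra.
  rewrite lebesgue_measure_itv/= lte_fin; case: ifP => _.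
    by rewrite -EFinB -EFinM lee_fin; lra.
  by rewrite -EFinM lee_fin; lra.
have -> : 1%E = lebesgue_measure (`[0%R, 1%R[ : set R).
  by rewrite lebesgue_measure_itv/= lte_fin ltr01 -EFinB subr0.
apply: (@le_trans _ _ (\sum_(i <oo) lebesgue_measure (W i))%E).
  apply: measure_sigma_subadditive => [i||u] //.
    by have [] := Wp i.
  rewrite /= in_itv/= => u1; have [i _ Ui] := AU _ (Ax _ u1).
  by exists i => //; have [_ + _] := Wp i; exact.
by apply: lee_nneseries => i *; [exact: measure_ge0|have [] := Wp i].
Qed.

End HolderParametrization.

(** * Subdivision of an interval in given proportions *)

Section Selection.
Context {R : realType} (w : nat -> R).
Hypothesis w_gt0 : forall k, 0 < w k.
Implicit Types (l : seq nat) (t : R).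

(* [0, sum_(k <- l) w k[ is cut into consecutive intervals of lengths [w k];
   [select l t] is the index of the interval containing [t] together with the
   relative position of [t] in it. *)
Fixpoint select l t : nat * R :=
  if l is k :: l' then
    if t < w k then (k, t / w k) else select l' (t - w k)
  else (0%N, 0).

Lemma selectP l t : 0 <= t < \sum_(k <- l) w k ->
  (select l t).1 \in l /\ 0 <= (select l t).2 < 1.
Proof.
elim: l t => [|k l IH] t; first by rewrite big_nil => /andP[? ?]; exfalso; lra.
rewrite big_cons /= => /andP[t0 tS]; case: ltP => [tk|kt] /=.
  by rewrite mem_head divr_ge0 ?ltr_pdivrMr ?mul1r// ltW.
have [|? ?] := IH (t - w k); first by apply/andP; split; lra.
by rewrite inE; split=> //; apply/orP; right.
Qed.

(** Without repetitions in [l], equal indices mean the same interval, on which the relative position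
    is affine of slope 1 / w. *)
Lemma select_dist l t t' : uniq l ->
  0 <= t < \sum_(k <- l) w k -> 0 <= t' < \sum_(k <- l) w k ->
  (select l t).1 = (select l t').1 ->
  `|t - t'| = w (select l t).1 * `|(select l t).2 - (select l t').2|.
Proof.
elim: l t t' => [|k l IH] t t'; first by rewrite big_nil => _ /andP[? ?]; exfalso; lra.
rewrite big_cons /= => /andP[kl ul] /andP[t0 tS] /andP[t'0 t'S].
have wk := w_gt0 k.
case: ltP => [tk|kt]; case: ltP => [t'k|kt'] /=.
- by move=> _; rewrite -mulrBl normrM [X in _ * (_ * X)]gtr0_norm ?invr_gt0//; field; lra.
- have [|kin _] := selectP l (t' - w k); first by apply/andP; split; lra.
  by move=> kE; rewrite kE kin in kl.
- have [|kin _] := selectP l (t - w k); first by apply/andP; split; lra.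
  by move=> kE; rewrite -kE kin in kl.
- move=> kE; rewrite -(IH _ _ ul _ _ kE); first by congr `|_|; ring.
  + by apply/andP; split; lra.
  + by apply/andP; split; lra.
Qed.

End Selection.

(** * Coding of [0, 1[ by digit sequences *)

Section CantorParametrization.
Context {R : realType} (s : R).
Hypothesis s_ge0 : 0 <= s.
Implicit Types (A : nat -> seq nat) (u v K : R) (n : nat).

(** The base (k + 1)^(-2) is the least factor by which x |-> 1 / (k + x) scales distances on [0, 1];
    this is why k + 1 replaces k. *)
Definition digit_weight (k : nat) : R := (k.+1%:R ^- 2) `^ s.

Lemma one_powR : 1 `^ s = 1 :> R.
Proof. by rewrite powR1. Qed.

Lemma digit_weight_gt0 k : 0 < digit_weight k.
Proof. by rewrite powR_gt0// invr_gt0 exprn_gt0. Qed.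

Lemma digit_weight_le1 k : digit_weight k <= 1.
Proof.
rewrite -[leRHS]one_powR ge0_ler_powR ?nnegrE ?invr_ge0 ?exprn_ge0//.
by rewrite invf_le1 ?exprn_gt0// -[leLHS](expr1n _ 2) lerXn2r ?nnegrE// ler1n.
Qed.

Definition total_weight (l : seq nat) : R := \sum_(k <- l) digit_weight k.

Definition alphabet l := [/\ l != [::], uniq l & forall k, k \in l -> (0 < k)%N].

Lemma total_weight_gt0 l : l != [::] -> 0 < total_weight l.
Proof.
case: l => // k l _; rewrite /total_weight big_cons.
by rewrite ltr_pwDl ?digit_weight_gt0// sumr_ge0// => i _; exact/ltW/digit_weight_gt0.
Qed.

Definition step l u := select digit_weight l (u * total_weight l).

Fixpoint digits A u n : nat :=
  if n is n'.+1 then digits (A \o succn) (step (A 0%N) u).2 n' else (step (A 0%N) u).1.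

Lemma digits_shift A u : digits A u \o succn = digits (A \o succn) (step (A 0%N) u).2.
Proof. by []. Qed.

Lemma step_range {l u} : l != [::] -> 0 <= u < 1 -> 0 <= u * total_weight l < total_weight l.
Proof.
move=> /total_weight_gt0 l0 /andP[u0 u1].
by rewrite mulr_ge0 ?(ltW l0)//= gtr_pMl.
Qed.

Lemma stepP {l u} : l != [::] -> 0 <= u < 1 ->
  (step l u).1 \in l /\ 0 <= (step l u).2 < 1.
Proof. by move=> l0 u1; apply/selectP/step_range => //; exact: digit_weight_gt0. Qed.

Lemma step_dist {l u v} : alphabet l -> 0 <= u < 1 -> 0 <= v < 1 ->
  (step l u).1 = (step l v).1 ->
  `|u - v| * total_weight l = digit_weight (step l u).1 * `|(step l u).2 - (step l v).2|.
Proof.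
move=> [l0 ul _] u1 v1 uv.
rewrite -(select_dist _ digit_weight_gt0 _ _ _ ul (step_range l0 u1) (step_range l0 v1) uv).
by rewrite -mulrBl normrM [X in _ = _ * X]gtr0_norm// total_weight_gt0.
Qed.

Lemma digits_mem {A u} n : (forall i, alphabet (A i)) -> 0 <= u < 1 ->
  digits A u n \in A n.
Proof.
elim: n A u => [|n IH] A u Aa u1; have [A0 _ _] := Aa 0%N; have [? ?] := stepP A0 u1 => //.
by apply: (IH (A \o succn)) => // i; exact: Aa.
Qed.

Lemma digits_positive {A u} : (forall i, alphabet (A i)) -> 0 <= u < 1 ->
  positive_digits (digits A u).
Proof. by move=> Aa u1 n; have [_ _] := Aa n; apply; exact: digits_mem. Qed.

(** By [step_dist] each common digit trades a factor S_i for a weight at most 1. This shows later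
    that distinct parameters have distinct digit sequences. *)
Lemma digits_agree A u v n : (forall i, alphabet (A i)) -> 0 <= u < 1 -> 0 <= v < 1 ->
  (forall i, (i < n)%N -> digits A u i = digits A v i) ->
  `|u - v| * \prod_(i < n) total_weight (A i) <= 1.
Proof.
elim: n A u v => [|n IH] A u v Aa u1 v1 uv.
  rewrite big_ord0 mulr1 ler_norml.
  by case/andP: u1 v1 => ? ? /andP[? ?]; apply/andP; split; lra.
have [A0 _ _] := Aa 0%N; have [_ u2] := stepP A0 u1; have [_ v2] := stepP A0 v1.
rewrite big_ord_recl mulrA (step_dist (Aa 0%N) u1 v1 (uv 0%N isT)) -mulrA.
rewrite mulr_ile1 ?digit_weight_le1 ?mulr_ge0 ?prodr_ge0 ?(ltW (digit_weight_gt0 _))//.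
  by move=> i _; apply/ltW/total_weight_gt0; have [] := Aa (lift ord0 i).
apply: (IH (A \o succn)) => // i; first exact: Aa.
by move=> ni; exact: (uv i.+1).
Qed.

(* As the second digits are at least 2, both tails are at most 1/2 and cannot
   compensate the difference of the first digits. *)
Lemma cf_dist_head {b c : nat -> nat} {K} : positive_digits b -> positive_digits c ->
  (2 <= b 1%N)%N -> (2 <= c 1%N)%N -> (b 0%N).+1%:R <= K -> (c 0%N).+1%:R <= K ->
  b 0%N != c 0%N -> 1 <= 2 * K ^+ 2 * `|cf b - cf c|.
Proof.
have tail (e : nat -> nat) : positive_digits e -> (2 <= e 1%N)%N ->
    0 <= (cf (e \o succn) : R) <= 2^-1.
  move=> e0 e1; have e2 := positive_digits_shift e0.
  have /andP[c0 c1] := cf01 e2 (R := R); rewrite c0/= (cf_rec e2).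
  have /andP[d0 d1] := cf01 (positive_digits_shift e2) (R := R).
  have : 2 <= (e 1%N)%:R :> R by rewrite ler_nat.
  rewrite -[(e \o succn) 0%N]/(e 1%N); move: d0 d1; set z := cf _ => d0 d1 e2'.
  by rewrite lef_pV2 ?posrE; lra.
wlog bc : b c / (b 0%N < c 0%N)%N.
  move=> H b0 c0 b1 c1 bK cK; rewrite neq_ltn => /orP[bc|cb].
    by apply: H; rewrite // neq_ltn bc.
  by rewrite distrC; apply: H; rewrite // neq_ltn cb.
move=> b0 c0 b1 c1 bK cK _.
have /andP[x0 x1] := tail _ b0 b1; have /andP[y0 y1] := tail _ c0 c1.
rewrite (cf_rec b0) (cf_rec c0).
have := natr_ge1 (b0 0%N) (R := R); have := natr_ge1 (c0 0%N) (R := R).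
have : (b 0%N).+1%:R <= (c 0%N)%:R :> R by rewrite ler_nat.
move: bK cK; rewrite -!natr1.
move: x0 x1 y0 y1; set x := cf _; set y := cf _; set m := (b 0%N)%:R; set n := (c 0%N)%:R.
move=> x0 x1 y0 y1 mK nK mn n1 m1.
have p0 : 0 < (m + x) * (n + y) by apply: mulr_gt0; lra.
have -> : (m + x)^-1 - (n + y)^-1 = (n + y - (m + x)) / ((m + x) * (n + y)).
  by field; lra.
rewrite ger0_norm ?divr_ge0 ?(ltW p0)//; last lra.
rewrite mulrA ler_pdivlMr// mul1r.
have : (m + x) * (n + y) <= K * K by apply: ler_pM; lra.
have : 2^-1 <= n + y - (m + x) by lra.
rewrite expr2; nra.
Qed.

(** A common digit k contributes exactly (k + 1)^(-2s) on the left and at least that on the right,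
    since (k + x)(k + y) <= (k + 1)^2. At the first differing digit [cf_dist_head] applies. *)
Lemma digits_separated A u v n K : (forall i, alphabet (A i)) ->
  (forall k, k \in A n.+1 -> (2 <= k)%N) ->
  (forall k, k \in A n -> k.+1%:R <= K) ->
  0 <= u < 1 -> 0 <= v < 1 ->
  (forall i, (i < n)%N -> digits A u i = digits A v i) ->
  digits A u n != digits A v n ->
  `|u - v| * \prod_(i < n) total_weight (A i) <=
    (2 * K ^+ 2) `^ s * `|cf (digits A u) - cf (digits A v) : R| `^ s.
Proof.
have K2 : 0 <= 2 * K ^+ 2 by apply: mulr_ge0 => //; exact: sqr_ge0.
elim: n A u v => [|n IH] A u v Aa A2 AK u1 v1 uv.
  move=> uv0; rewrite big_ord0 mulr1 -powRM//.
  apply: (@le_trans _ _ 1).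
    rewrite ler_norml.
    by case/andP: u1 v1 {uv} => ? ? /andP[? ?]; apply/andP; split; lra.
  rewrite -[leLHS]one_powR ge0_ler_powR ?nnegrE ?(mulr_ge0 K2)//.
  apply: cf_dist_head => //; try exact: digits_positive.
  - by apply/A2/digits_mem.
  - by apply/A2/digits_mem.
  - by apply/AK/digits_mem.
  - by apply/AK/digits_mem.
have [A0 _ _] := Aa 0%N; have [_ u2] := stepP A0 u1; have [_ v2] := stepP A0 v1.
have uv0 := uv 0%N isT; rewrite /= in uv0.
move=> /= uvn.
have := IH (A \o succn) _ _ (fun i => Aa i.+1) A2 AK u2 v2 (fun i => uv i.+1) uvn.
have pu := digits_positive Aa u1; have pv := digits_positive Aa v1.
have /andP[xu0 xu1] := cf01 (R := R) (positive_digits_shift pu).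
have /andP[xv0 xv1] := cf01 (R := R) (positive_digits_shift pv).
rewrite (cf_rec pu) (cf_rec pv) !digits_shift.
move: xu0 xu1 xv0 xv1; rewrite !digits_shift /= -uv0.
set x := cf _; set y := cf _; set k := (step _ _).1 => x0 x1 y0 y1 le.
rewrite big_ord_recl mulrA (step_dist (Aa 0%N) u1 v1 uv0) -mulrA.
apply: (le_trans (ler_wpM2l (ltW (digit_weight_gt0 _)) le)).
rewrite mulrCA ler_wpM2l ?powR_ge0// -powRM// ?invr_ge0 ?exprn_ge0//.
have k1 : 1 <= k%:R :> R by apply/natr_ge1; have := pu 0%N.
rewrite ge0_ler_powR ?nnegrE ?mulr_ge0 ?invr_ge0 ?exprn_ge0//.
rewrite dist_invD; [|lra..].
rewrite mulrC ler_wpM2l// lef_pV2 ?posrE -?natr1 ?expr2; nra.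
Qed.

End CantorParametrization.

(** * Lower bound: the Hölder estimate for slowly growing alphabets *)

Section LowerBound.
Context {R : realType} (s : R).
Hypothesis s_ge0 : 0 <= s.

Lemma expr2_unbounded (x : R) : \forall n \near \oo, x <= 2 ^+ n.
Proof.
near=> n; apply: (@le_trans _ _ n%:R); first by near: n; exact: nbhs_infty_ger.
by rewrite -natrX ler_nat ltnW// ltn_expl.
Unshelve. all: by end_near. Qed.

Section HolderDigits.
Variables (A : nat -> seq nat) (N : nat).
Hypothesis A_alphabet : forall n, alphabet (A n).
Hypothesis A_head : forall n, (n < N)%N -> size (A n) = 1%N.
Hypothesis A_tail : forall n, (N <= n)%N ->
  [/\ forall k, k \in A n -> (2 <= k)%N, 2 <= total_weight s (A n) &
      exists2 K : R, (forall k, k \in A n -> k.+1%:R <= K) &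
                     (2 * K ^+ 2) `^ s <= 2 ^+ n].

Let prod_weight n : R := \prod_(i < n) total_weight s (A i).

Lemma prod_weight_gt0 n : 0 < prod_weight n.
Proof. by apply: prodr_gt0 => i _; apply: total_weight_gt0; have [] := A_alphabet i. Qed.

Lemma prod_weight_ge n : prod_weight N * 2 ^+ n <= prod_weight (N + n).
Proof.
elim: n => [|n IH]; first by rewrite addn0 mulr1.
rewrite addnS /prod_weight big_ord_recr/= exprSr mulrA ler_pM//.
  by rewrite mulr_ge0 ?exprn_ge0// ltW// prod_weight_gt0.
by have [] := A_tail (N + n)%N (leq_addr _ _).
Qed.

(** The first N alphabets are singletons, so digits first differ at some n >= N. There the
    separation constant is at most 2^n while the product of the S_i is at least P_N 2^(n - N), with
    P_N = [prod_weight N]; the quotient 2^N / P_N does not depend on n. *)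
Lemma digits_holder u v : 0 <= u < 1 -> 0 <= v < 1 ->
  `|u - v| <= 2 ^+ N / prod_weight N *
    `|cf (digits s A u) - cf (digits s A v) : R| `^ s.
Proof.
move=> u1 v1; have P0 := prod_weight_gt0 N.
have [[n0 n0P]|agree] := pselect (exists n, digits s A u n != digits s A v n).
  have {n0 n0P} [n uvn nmin] :=
    ex_minnP (ex_intro (fun n => digits s A u n != digits s A v n) n0 n0P).
  have Nn : (N <= n)%N.
    rewrite leqNgt; apply/negP => /A_head.
    have := digits_mem s n A_alphabet v1; have := digits_mem s n A_alphabet u1.
    case: (A n) => [|k [|? ?]]//; rewrite !inE => /eqP uk /eqP vk _.
    by rewrite uk vk eqxx in uvn.
  have [_ _ [K AK Ks]] := A_tail n Nn.
  have [A2 _ _] := A_tail n.+1 (leqW Nn).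
  have uv i : (i < n)%N -> digits s A u i = digits s A v i.
    by move=> ni; apply/eqP; apply: contraTT ni => /nmin; rewrite -leqNgt.
  have := digits_separated s s_ge0 A u v n K A_alphabet A2 AK u1 v1 uv uvn.
  rewrite -/(prod_weight n); set D := `|cf _ - _| `^ s => le.
  have D0 : 0 <= D by exact: powR_ge0.
  have := prod_weight_ge (n - N); rewrite subnKC// => Pn.
  have e0 : 0 < 2 ^+ (n - N) :> R by rewrite exprn_gt0.
  have d0 := normr_ge0 (u - v).
  rewrite mulrAC ler_pdivlMr// -(ler_pM2r e0).
  have -> : 2 ^+ N * D * 2 ^+ (n - N) = 2 ^+ n * D.
    by rewrite mulrAC -exprD subnKC.
  rewrite -mulrA (le_trans (ler_wpM2l d0 Pn))// (le_trans le)//.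
  by rewrite ler_wpM2r.
have uv i : digits s A u i = digits s A v i.
  by apply/eqP/negPn/negP => ne; apply: agree; exists i.
have [->|uv0] := eqVneq u v.
  by rewrite subrr normr0 mulr_ge0 ?powR_ge0// divr_ge0 ?exprn_ge0// ltW.
have d0 : 0 < `|u - v| by rewrite normr_gt0 subr_eq0.
(* If all digits agree, then |u - v| P_N 2^n <= 1 for every n, which fails for this n when u and v
   differ. *)
have [n _ /(_ n (leqnn n)) /= big] := expr2_unbounded ((`|u - v| * prod_weight N)^-1 + 1).
have := digits_agree s s_ge0 A u v (N + n) A_alphabet u1 v1 (fun i _ => uv i).
have := prod_weight_ge n; rewrite -/(prod_weight (N + n)) => /(ler_wpM2l (ltW d0)).
move=> /le_trans h /h; rewrite mulrA.
have dP : 0 < `|u - v| * prod_weight N by rewrite mulr_gt0.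
rewrite -ler_pdivlMl// mulr1 => {}h; exfalso; lra.
Qed.

End HolderDigits.

(** * Choice of alphabets adapted to [B] and [f] *)

Section Alphabets.
Variable B : set nat.
Hypothesis B_pos : B `<=` [set k | (0 < k)%N].
Hypothesis B_diverges : ~ (\esum_(k in B) (k%:R `^ (- (s * 2)))%:E < +oo :> \bar R)%E.

(** Otherwise every finite segment of [B] beyond m weighs less than 2. As k^(-2) <= 4 (k + 1)^(-2)
    for k >= 1, the partial sums of k^(-2s) beyond m would be bounded by 4^s * 2 and the series
    would converge. *)
Lemma exists_heavy_block m : exists l : seq nat,
  [/\ alphabet l, forall k, k \in l -> B k /\ (m <= k)%N & 2 <= total_weight s l].
Proof.
apply: contrapT => no; apply: B_diverges.
pose P k := `[< B k >].
have w0 k : P k -> (0 <= (k%:R `^ (- (s * 2)))%:E :> \bar R)%E.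
  by rewrite lee_fin powR_ge0.
have -> : B = [set k | P k] by apply/seteqP; split => k /asboolP.
rewrite -nneseries_esum// (nneseries_split_cond 0 m)// add0n sumEFin.
rewrite lte_add_pinfty ?ltry//.
apply: (@le_lt_trans _ _ (4 `^ s * 2)%:E); last exact: ltry.
apply: lime_le; first by apply: is_cvg_nneseries => k _; exact: w0.
apply: nearW => n; rewrite sumEFin lee_fin.
rewrite -big_filter.
have [->|lN0] := eqVneq [seq k <- index_iota m n | P k] [::].
  by rewrite big_nil mulr_ge0 ?powR_ge0.
have l_alphabet : alphabet [seq k <- index_iota m n | P k].
  split=> //; first by rewrite filter_uniq// iota_uniq.
  by move=> k; rewrite mem_filter => /andP[/asboolP/B_pos].
apply: (@le_trans _ _ (4 `^ s * total_weight s [seq k <- index_iota m n | P k])).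
  rewrite /total_weight mulr_sumr big_seq [leRHS]big_seq ler_sum// => k.
  rewrite mem_filter => /andP[/asboolP/B_pos k0 _].
  have -> : k%:R `^ (- (s * 2)) = (k%:R ^- 2) `^ s by rewrite mulrC -mulNr powRrM powR_invn.
  rewrite -powRM ?invr_ge0 ?exprn_ge0// ge0_ler_powR ?nnegrE ?mulr_ge0 ?invr_ge0 ?exprn_ge0//.
  have k1 : 1 <= k%:R :> R := natr_ge1 k0.
  have kp : 0 < k%:R :> R by lra.
  have k1p : 0 < k%:R + 1 :> R by lra.
  rewrite -natr1 ler_pdivlMr ?exprn_gt0// mulrC ler_pdivrMr ?exprn_gt0//.
  by rewrite !expr2; nra.
rewrite ler_pM2l ?powR_gt0// leNgt; apply/negP => lt2.
apply: no; exists [seq k <- index_iota m n | P k]; split=> //; last exact: ltW.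
by move=> k; rewrite mem_filter mem_index_iota => /and3P[/asboolP].
Qed.

Variables (k0 : nat) (f : nat -> R).
Hypothesis k0B : B k0.
Hypothesis f_ge : forall n, (0 < n)%N -> k0%:R <= f n.
Hypothesis f_cvg : f n @[n --> \oo] --> +oo.

(** Heavy blocks [F j] move off to infinity, and [F j] becomes admissible for [f] and for the growth
    bound from time [T j] on. Each block is kept until a later one is admissible; before time [T 0]
    the only digit is [k0], which [f] always allows. *)
Lemma exists_alphabets : exists (A : nat -> seq nat) (N : nat),
  [/\ forall n, alphabet (A n),
      forall n k, k \in A n -> B k /\ k%:R <= f n.+1,
      forall n, (n < N)%N -> size (A n) = 1%N,
      forall n, (N <= n)%N ->
        [/\ forall k, k \in A n -> (2 <= k)%N, 2 <= total_weight s (A n) &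
            exists2 K : R, (forall k, k \in A n -> k.+1%:R <= K) &
                           (2 * K ^+ 2) `^ s <= 2 ^+ n] &
      forall m, \forall n \near \oo, forall k, k \in A n -> (m <= k)%N].
Proof.
(* The shift by 2 makes all digits at least 2, as the separation estimate demands. *)
have /choice[F FP] := fun j => exists_heavy_block j.+2.
pose top j := (\max_(k <- F j) k)%N.
have topP j k : k \in F j -> (k <= top j)%N by move=> kF; exact: leq_bigmax_seq.
have /choice[T TP] : forall j, exists T, forall n, (T <= n)%N ->
    (top j)%:R <= f n.+1 /\ (2 * (top j).+1%:R ^+ 2) `^ s <= 2 ^+ n :> R.
  move=> j.
  have [T1 _ T1P] := expr2_unbounded ((2 * (top j).+1%:R ^+ 2) `^ s).
  have /cvgryPge /(_ (top j)%:R)[T2 _ T2P] := f_cvg.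
  exists (maxn T1 T2) => n; rewrite geq_max => /andP[n1 n2].
  by split; [exact: (T2P n.+1 (leqW n2))|exact: T1P].
(* The latest block among the first n + 1 that is admissible at time n. An empty maximum is 0,
   whence the condition [T 0 <= n] in [TJ]. *)
pose J n := (\max_(j < n.+1 | (T j <= n)%N) j)%N.
have TJ n : (T 0%N <= n)%N -> (T (J n) <= n)%N.
  move=> Tn; rewrite /J; elim/big_ind: _ => // x y xn yn.
  by rewrite /maxn; case: ifP.
have JT j n : (T j <= n)%N -> (j <= n)%N -> (j <= J n)%N.
  move=> Tj; rewrite -ltnS => jn.
  exact: (leq_bigmax_cond (Ordinal jn)).
exists (fun n => if (n < T 0%N)%N then [:: k0] else F (J n)), (T 0%N); split.
- move=> n; case: ifP => _; last by have [] := FP (J n).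
  by split=> // k; rewrite inE => /eqP ->; exact: B_pos.
- move=> n k; case: ltnP => [_|/TJ Tn]; first by rewrite inE => /eqP ->; split=> //; exact: f_ge.
  move=> kF; have [_ /(_ k kF)[Bk _] _] := FP (J n); split=> //.
  by have [tf _] := TP _ _ Tn; rewrite (le_trans _ tf)// ler_nat topP.
- by move=> n ->.
- move=> n Tn; rewrite ltnNge Tn/=; have [_ FB F2] := FP (J n); split=> //.
    by move=> k /FB[_]; apply: leq_trans.
  exists (top (J n)).+1%:R; last by have [] := TP _ _ (TJ n Tn).
  by move=> k kF; rewrite ler_nat ltnS topP.
- move=> m; exists (maxn (T 0%N) (maxn m (T m))) => // n /=.
  rewrite !geq_max => /and3P[T0n mn Tmn] k; rewrite ltnNge T0n/= => kF.
  have [_ /(_ k kF)[_ Jk] _] := FP (J n).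
  by rewrite (leq_trans (JT m n Tmn mn))// (leq_trans _ Jk)// leqW.
Qed.

Lemma hausdorff_measure_G_neq0 : hausdorff_measure s (G B f : set R^o) != 0%E.
Proof.
have [A [N [Aa AB A1 A2 Am]]] := exists_alphabets.
have Apos u : 0 <= u < 1 -> positive_digits (digits s A u).
  by move=> u1; exact: digits_positive.
apply: (@hausdorff_measure_neq0 _ _ (fun u => cf (digits s A u)) s
  (2 ^+ N / \prod_(i < N) total_weight s (A i))) => //.
- by rewrite divr_gt0 ?exprn_gt0//; exact: prod_weight_gt0.
- move=> u u1; split; first exact/irrational01_cf/Apos.
    move=> [//|n] _; rewrite partial_quotient_cf; last exact: Apos.
    by apply: AB; exact: digits_mem.
  rewrite partial_quotient_cf; last exact: Apos.
  move=> P [m _ mP]; have [M _ MP] := Am m.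
  exists M.+1 => // -[//|n] Mn; apply: mP => /=.
  by apply: (MP n Mn); exact: digits_mem.
- by move=> u v; exact: digits_holder.
Qed.

End Alphabets.
End LowerBound.

(** * Hausdorff dimension and exponent of convergence *)

Lemma esum_infinite_set (R : realType) (T : choiceType) (A : set T) : infinite_set A ->
  (\esum_(i in A) 1 = +oo :> \bar R)%E.
Proof.
move=> A_infinite; apply/eqyP => x x0.
have [X XA xX] := infinite_set_fset (Num.truncn x).+1 A_infinite.
apply: esum_ge; eexists; first by split; [exact: finite_fset X|exact: XA].
rewrite fsbig_finite//= set_fsetK sumEFin lee_fin.
by rewrite big_const_seq count_predT iter_addr_0 (le_trans (ltW (truncnS_gt x)))// ler_nat.
Qed.

Theorem theorem1 (R : realType) (B : set nat)
    (B_pos : B `<=` [set k | (0 < k)%N]) (B_infinite : infinite_set B)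
    (minB : nat) (minB_in : B minB) (minB_le : forall k, B k -> (minB <= k)%N)
    (f : nat -> R) (f_ge : forall n, (0 < n)%N -> minB%:R <= f n)
    (f_cvg : f n @[n --> \oo] --> +oo) :
  hausdorff_dim (G B f : set R^o) = (exponent_of_convergence R B / 2%:E)%E.
Proof.
have inve2 : (2%:E^-1 = 2^-1%:E :> \bar R)%E by rewrite inver pnatr_eq0.
apply/eqP; rewrite eq_le inve2; apply/andP; split.
  rewrite lee_pdivlMr//; apply: le_ereal_inf_tmp => _ [s [s0 sfin] <-].
  (* At exponent 0 every term is 1 and the sum over the infinite set [B] diverges. *)
  have {}s0 : 0 < s.
    rewrite lt_neqAle s0 andbT; apply/eqP => s00; move: sfin.
    by rewrite -s00 oppr0; under eq_esum do rewrite powRr0; rewrite esum_infinite_set.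
  rewrite -lee_pdivlMr// -EFinM; apply: ereal_inf_lbound; exists (s / 2) => //.
  split; first by rewrite ltW// divr_gt0.
  by apply: hausdorff_measure_G_eq0 => //; [exact: divr_gt0|rewrite divfK].
apply: le_ereal_inf_tmp => _ [s [s0 sG] <-].
rewrite lee_pdivrMr// -EFinM; apply: ereal_inf_lbound; exists (s * 2) => //.
split; first exact: mulr_ge0.
apply: contrapT => div.
by have := hausdorff_measure_G_neq0 s s0 B B_pos div minB f minB_in f_ge f_cvg; rewrite sG eqxx.
Qed.
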